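(* Let $g\ge 1$ and $k\ge 1$ be integers with $2g\ge k+2$. Then, as subspaces of $\mathfrak{h}^{\mathbb{Q}}_{g,1}(k)$, $$\mathrm{Ker}(c_k)\subset \mathrm{Ker}(\delta^{\mathrm{alg}}_k).$$
   Context: Let $H_{\mathbb{Q}}=H_1(\Sigma_{g,1};\mathbb{Q})$ for a compact oriented surface $\Sigma_{g,1}$ of genus $g$ with one boundary component; it has dimension $2g$ and carries the nondegenerate skew-symmetric intersection form $\langle\cdot,\cdot\rangle$. Identify $H_{\mathbb{Q}}$ with $H_{\mathbb{Q}}^*$ via $v\mapsto\langle v,\cdot\rangle$ (Poincaré duality); for $a\in H_\mathbb{Q}$ write $a^*=\langle a,\cdot\rangle$. Let $\mathcal{L}^{\mathbb{Q}}_{2g}(m)\subset H_{\mathbb{Q}}^{\otimes m}$ be the degree-$m$ part of the free Lie algebra on $H_\mathbb{Q}$, realized inside the tensor algebra as the span of left-normed brackets $[a_1,\dots,a_m]=[\cdots[[a_1,a_2],a_3],\dots,a_m]$ with $[x,y]=x\otimes y-y\otimes x$. Define $\mathfrak{h}^{\mathbb{Q}}_{g,1}(k)$ to be the kernel of the bracket map $H_\mathbb{Q}\otimes\mathcal{L}^{\mathbb{Q}}_{2g}(k+1)\to\mathcal{L}^{\mathbb{Q}}_{2g}(k+2)$, $X\otimes u\mapsto[X,u]$; it is a subspace of $H_\mathbb{Q}^{\otimes k+2}$. For $m\ge 0$, let $\mathcal{C}^{\mathbb{Q}}_{2g}(m)$ be the quotient of $H_\mathbb{Q}^{\otimes m}$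 by the span of all $a_1\otimes a_2\otimes\cdots\otimes a_m-a_2\otimes\cdots\otimes a_m\otimes a_1$ (so $\mathcal{C}^\mathbb{Q}_{2g}(0)=\mathbb{Q}$), with projection $\pi_m:H_\mathbb{Q}^{\otimes m}\to\mathcal{C}^\mathbb{Q}_{2g}(m)$; write $\pi$ for $\pi_m$ when $m$ is clear. The map $c_k:\mathfrak{h}^\mathbb{Q}_{g,1}(k)\to\mathcal{C}^\mathbb{Q}_{2g}(k)$ is the restriction of $a_0\otimes a_1\otimes\cdots\otimes a_{k+1}\mapsto \langle a_0,a_1\rangle\,\pi_k(a_2\otimes\cdots\otimes a_{k+1})$. The map $\delta_k^{\mathrm{alg}}:H_\mathbb{Q}^{\otimes k+2}\to\bigoplus_{p,q\ge1,\,p+q=k}\mathcal{C}^\mathbb{Q}_{2g}(p)\otimes\mathcal{C}^\mathbb{Q}_{2g}(q)$ sends $a_1\otimes\cdots\otimes a_{k+2}$ to $$\sum_{\substack{1\le i<j\le k+2\\ 1<j-i<k+1}} a_i^*(a_j)\Big(\pi(a_{i+1}\otimes\cdots\otimes a_{j-1})\otimes\pi(a_{j+1}\otimes\cdots\otimes a_{k+2}\otimes a_1\otimes\cdots\otimes a_{i-1}) - \pi(a_{j+1}\otimes\cdots\otimes a_{k+2}\otimes a_1\otimes\cdots\otimes a_{i-1})\otimes\pi(a_{i+1}\otimes\cdots\otimes a_{j-1})\Big);$$ the same symbol denotes its restriction to $\mathfrak{h}^\mathbb{Q}_{g,1}(k)$. (For $k=1$ the target is $0$.) *)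

(* Defs.v *)
From HB Require Import structures.
From mathcomp Require Import all_boot all_order all_algebra.
Set Implicit Arguments. Unset Strict Implicit. Unset Printing Implicit Defensive.
Import GRing.Theory.
Local Open Scope ring_scope.

(* H_Q = Q^n in coordinates w.r.t. a fixed basis e_0..e_(n-1); n = 2g. *)
Notation vecH n := {ffun 'I_n -> rat}.
(* H_Q^{(x) m}: coefficient functions on words of length m in the basis. *)
Notation tens n m := {ffun m.-tuple 'I_n -> rat}.
Notation bitens n p q := {ffun (p.-tuple 'I_n * q.-tuple 'I_n) -> rat}.

Definition init_tuple n m (w : m.+1.-tuple 'I_n) : m.-tuple 'I_n :=
  [tuple tnth w (widen_ord (leqnSn m) j) | j < m].

Definition lmul n m (v : vecH n) (x : tens n m) : tens n m.+1 :=
  [ffun w : m.+1.-tuple 'I_n => v (thead w) * x (behead_tuple w)].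
Definition rmul n m (x : tens n m) (v : vecH n) : tens n m.+1 :=
  [ffun w : m.+1.-tuple 'I_n => x (init_tuple w) * v (tnth w ord_max)].

Fixpoint lbrack (n m : nat) : ('I_m.+1 -> vecH n) -> tens n m.+1 :=
  match m return ('I_m.+1 -> vecH n) -> tens n m.+1 with
  | 0 => fun a => [ffun w : 1.-tuple 'I_n => a ord0 (thead w)]
  | m'.+1 => fun a =>
      let b := @lbrack n m' (fun j : 'I_m'.+1 => a (widen_ord (leqnSn m'.+1) j)) in
      rmul b (a ord_max) - lmul (a ord_max) b
  end.

(* u lies in L_{n}(m+1): it is a (finite) linear combination of left-normed
   brackets; scalars are absorbed into the first entry by linearity. *)
Definition isLie n m (u : tens n m.+1) : Prop :=
  exists r (A : 'I_r -> 'I_m.+1 -> vecH n), u = \sum_(j < r) @lbrack n m (A j).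

Definition etens n m (a : 'I_m -> vecH n) : tens n m :=
  [ffun w : m.-tuple 'I_n => \prod_(i < m) a i (tnth w i)].

Definition cycrel n m (a : 'I_m -> vecH n) : tens n m :=
  etens a - etens (fun i => a (ordS i)).

(* y is in the kernel of pi_m : H^{(x)m} -> C(m) *)
Definition kerpi n m (y : tens n m) : Prop :=
  exists r (A : 'I_r -> 'I_m -> vecH n), y = \sum_(j < r) cycrel (A j).

Definition outer n p q (x : tens n p) (y : tens n q) : bitens n p q :=
  [ffun w : p.-tuple 'I_n * q.-tuple 'I_n => x w.1 * y w.2].

(* y is in the kernel of pi_p (x) pi_q : H^{(x)p} (x) H^{(x)q} -> C(p) (x) C(q),
   i.e. in ker(pi_p) (x) H^{(x)q} + H^{(x)p} (x) ker(pi_q). *)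
Definition kerpi2 n p q (y : bitens n p q) : Prop :=
  exists r1 (A : 'I_r1 -> 'I_p -> vecH n) (B : 'I_r1 -> 'I_q -> vecH n)
         r2 (A' : 'I_r2 -> 'I_p -> vecH n) (B' : 'I_r2 -> 'I_q -> vecH n),
    y = \sum_(j < r1) outer (cycrel (A j)) (etens (B j))
      + \sum_(j < r2) outer (etens (A' j)) (cycrel (B' j)).

(* basis tensor e_s and basis bitensor e_s1 (x) e_s2 (zero if lengths mismatch) *)
Definition tb n m (s : seq 'I_n) : tens n m :=
  [ffun w : m.-tuple 'I_n => (val w == s)%:R].
Definition bb n p q (s1 s2 : seq 'I_n) : bitens n p q :=
  [ffun w : p.-tuple 'I_n * q.-tuple 'I_n => ((val w.1 == s1) && (val w.2 == s2))%:R].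

Definition brk n m (v : vecH n) (u : tens n m) : tens n m.+1 := lmul v u - rmul u v.

(* c_k, before projection pi_k: linear extension of
   a_0 (x) a_1 (x) ... (x) a_{k+1} |-> <a_0,a_1> a_2 (x) ... (x) a_{k+1},
   where om i j = <e_i, e_j>. *)
Definition ck_pre n k (om : 'M[rat]_n) (x : tens n k.+2) : tens n k :=
  [ffun y : k.-tuple 'I_n => \sum_(w : k.+2.-tuple 'I_n)
     x w * om (tnth w ord0) (tnth w (inord 1)) * @tb n k (drop 2 w) y].

(* (p,q)-component of delta_k^alg, before projection pi_p (x) pi_q; 0-indexed
   positions i<j of a word w correspond to a_{i+1}, a_{j+1}. *)
Definition delta_pre n k p q (om : 'M[rat]_n) (x : tens n k.+2) : bitens n p q :=
  [ffun y : p.-tuple 'I_n * q.-tuple 'I_n => \sum_(w : k.+2.-tuple 'I_n) x w *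
    \sum_(i < k.+2) \sum_(j < k.+2 | (i < j)%N && (1 < j - i < k.+1)%N)
       om (tnth w i) (tnth w j) *
         (@bb n p q (take (j - i - 1)%N (drop i.+1 w)) (drop j.+1 w ++ take i w) y
        - @bb n p q (drop j.+1 w ++ take i w) (take (j - i - 1)%N (drop i.+1 w)) y)].

(* Main.v *)
Require Import Defs.
From HB Require Import structures.
From mathcomp Require Import all_boot all_order all_algebra.
From mathcomp Require Import ring.
Set Implicit Arguments. Unset Strict Implicit. Unset Printing Implicit Defensive.
Import GRing.Theory Num.Theory.
Local Open Scope ring_scope.

(* Vanishing under the bracket map says that x in H (x) L(k+1) is invariant
   under rotation, so that delta_k(x) is a multiple of the double contraction
   sum <a_0, a_(p+1)> a_1..a_p (x) a_(p+2)..a_(k+1).  For a Lie element u, the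
   sum of phi(a_l) a_1..a_(l-1) (x) a_(l+1)..a_m equals (S (x) 1) Delta of the
   contraction of phi with the first letter of u, where S and Delta are the
   antipode and the coproduct of the tensor algebra; this is checked on
   left-normed brackets.  Hence the double contraction of x is
   (S (x) 1) Delta (c_k(x)), and (S (x) 1) Delta descends to cyclic words.
   Tensors are handled through their coefficients on words, the kernels of the
   projections to cyclic words through sums over rotations. *)

(** * Signed shuffles: (S (x) 1) Delta on coefficients *)

Section SignedShuffles.

Variables (T : finType) (R : comNzRingType).
Implicit Types (f : seq T -> R) (r s t : seq T) (v phi : T -> R).

(* The coefficient of s (x) t in (S (x) 1) Delta f is ashuf (rev s) t f: up to the
   sign of |s|, the sum of f over the shuffles of rev s and t. *)
Fixpoint ashuf r : seq T -> (seq T -> R) -> R :=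
  if r is x :: r' then
    fix ashuf_t t f := - ashuf r' t (fun w => f (x :: w))
      + (if t is y :: t' then ashuf_t t' (fun w => f (y :: w)) else 0)
  else fun t f => f t.

Lemma ashuf_nil t f : ashuf [::] t f = f t.
Proof. by []. Qed.

Lemma ashuf_cons_nil x r f :
  ashuf (x :: r) [::] f = - ashuf r [::] (fun w => f (x :: w)).
Proof. exact: addr0. Qed.

Lemma ashuf_cons x r y t f : ashuf (x :: r) (y :: t) f =
  - ashuf r (y :: t) (fun w => f (x :: w)) + ashuf (x :: r) t (fun w => f (y :: w)).
Proof. by []. Qed.

Lemma eq_in_ashuf g f r t :
  (forall w, size w = (size r + size t)%N -> f w = g w) -> ashuf r t f = ashuf r t g.
Proof.
elim: r t g f => [|x r IHr] t; first by move=> g f fg; rewrite !ashuf_nil fg.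
elim: t => [|y t IHt] g f fg; rewrite ?ashuf_cons_nil ?ashuf_cons.
  by congr (- _); apply: IHr => w sw; rewrite fg //= sw.
by congr (- _ + _); [apply: IHr | apply: IHt] => w sw; rewrite fg //= sw ?addnS.
Qed.

Lemma eq_ashuf g f r t : f =1 g -> ashuf r t f = ashuf r t g.
Proof. by move=> fg; apply: eq_in_ashuf. Qed.

Lemma ashufD r t f g : ashuf r t (fun w => f w + g w) = ashuf r t f + ashuf r t g.
Proof.
elim: r t f g => [|x r IHr] // t; elim: t => [|y t IHt] f g.
  by rewrite !ashuf_cons_nil IHr opprD.
by rewrite !ashuf_cons IHr IHt; ring.
Qed.

Lemma ashufZ r t (a : R) f : ashuf r t (fun w => a * f w) = a * ashuf r t f.
Proof.
elim: r t f => [|x r IHr] // t; elim: t => [|y t IHt] f.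
  by rewrite !ashuf_cons_nil IHr mulrN.
by rewrite !ashuf_cons IHr IHt; ring.
Qed.

Lemma ashuf0 r t : ashuf r t (fun=> 0) = 0.
Proof.
rewrite -[RHS](mul0r (ashuf r t (fun=> 0))) -ashufZ.
by apply: eq_ashuf => w; rewrite mul0r.
Qed.

Lemma ashuf_sum (I : Type) (e : seq I) (F : I -> seq T -> R) r t :
  ashuf r t (fun w => \sum_(i <- e) F i w) = \sum_(i <- e) ashuf r t (F i).
Proof.
elim: e => [|i e IHe].
  by rewrite big_nil -[RHS](ashuf0 r t); apply: eq_ashuf => w; rewrite big_nil.
by rewrite big_cons -IHe -ashufD; apply: eq_ashuf => w; rewrite big_cons.
Qed.

Lemma ashuf_rcons_nil x r f :
  ashuf (rcons r x) [::] f = - ashuf r [::] (fun w => f (rcons w x)).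
Proof.
elim: r f => [|y r IHr] f; first by rewrite ashuf_cons_nil.
by rewrite rcons_cons !ashuf_cons_nil IHr.
Qed.

(** A shuffle also ends with the last letter of one of its two words. The definition peels letters
    from the front; right multiplication and rotation need them peeled from the back. *)
Lemma ashuf_rcons x y r t f : ashuf (rcons r x) (rcons t y) f =
  - ashuf r (rcons t y) (fun w => f (rcons w x))
  + ashuf (rcons r x) t (fun w => f (rcons w y)).
Proof.
elim: r t f => [|a r IHr] t; elim: t => [|b t IHt] f.
- by rewrite /= !addr0 addrC.
- rewrite rcons_cons ashuf_cons (IHt (fun w => f (b :: w))).
  by rewrite ashuf_cons /=; ring.
- rewrite rcons_cons ashuf_cons (IHr [::]) ashuf_cons !ashuf_cons_nil /=.
  by rewrite (ashuf_rcons_nil _ _ (fun w => f [:: y, a & w])) /=; ring.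
rewrite !rcons_cons !ashuf_cons -!rcons_cons IHr.
by rewrite IHt /=; ring.
Qed.

Arguments ashuf : simpl never.

(** * Lie series: primitivity and contraction with a functional *)

Definition lmulw v f s := if s is x :: s' then v x * f s' else 0.
Definition rmulw f v s := if s is x :: s' then f (belast x s') * v (last x s') else 0.

Lemma rmulw_rcons f v s x : rmulw f v (rcons s x) = f s * v x.
Proof. by case: s => [|y s] //=; rewrite last_rcons belast_rcons. Qed.

Lemma ashuf_rmulw f v r x t y : ashuf (rcons r x) (rcons t y) (rmulw f v) =
  - (v x * ashuf r (rcons t y) f) + v y * ashuf (rcons r x) t f.
Proof.
rewrite ashuf_rcons -!ashufZ.
by congr (- _ + _); apply: eq_ashuf => w; rewrite rmulw_rcons mulrC.
Qed.

Lemma ashuf_rmulw_nil f v r x :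
  ashuf (rcons r x) [::] (rmulw f v) = - (v x * ashuf r [::] f).
Proof.
rewrite ashuf_rcons_nil -ashufZ.
by congr (- _); apply: eq_ashuf => w; rewrite rmulw_rcons mulrC.
Qed.

Lemma ashuf_lmulw f v r x t y : ashuf (x :: r) (y :: t) (lmulw v f) =
  - (v x * ashuf r (y :: t) f) + v y * ashuf (x :: r) t f.
Proof. by rewrite ashuf_cons -!ashufZ. Qed.

Lemma ashuf_lmulw_nil f v r x :
  ashuf (x :: r) [::] (lmulw v f) = - (v x * ashuf r [::] f).
Proof. by rewrite ashuf_cons_nil /= ashufZ. Qed.

(** Covers single left-normed brackets; their sums are treated by linearity in [dcontr_isLie].
    Pointwise equality in the constructors stands in for functional extensionality. *)
Inductive lie_series : (seq T -> R) -> Prop :=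
| LieLetter v f of f =1 lmulw v (fun w => (nilp w)%:R) : lie_series f
| LieBracket f v h of lie_series f & h =1 (fun s => rmulw f v s - lmulw v f s) :
    lie_series h.

Lemma lie_series_nil f : lie_series f -> f [::] = 0.
Proof. by case=> [v g -> | g v h _ ->]; rewrite ?subrr. Qed.

(** Compares peeling at the two ends: in a term that survives only when the rest of the word is
    empty, the first and last letters coincide. *)
Lemma rcons_consP x r : exists r0 x0, x :: r = rcons r0 x0 /\
  forall v (a : R),
    v x0 * (if nilp r0 then a else 0) = v x * (if nilp r then a else 0).
Proof.
exists (belast x r), (last x r); split; first exact: lastI.
by case: r => [|y r] v a //=; rewrite !mulr0.
Qed.

Lemma ashuf_unit r t : ashuf r t (fun w => (nilp w)%:R) = (nilp r && nilp t)%:R.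
Proof.
case: r t => [|x r] [|y t] //.
  by rewrite ashuf_cons_nil (ashuf0 r [::]) oppr0.
by rewrite ashuf_cons (ashuf0 r (y :: t)) (ashuf0 (x :: r) t) oppr0 addr0.
Qed.

(* Lie series are primitive: Delta f = f (x) 1 + 1 (x) f and S f = - f. *)
Lemma ashuf_lie f r t : lie_series f ->
  ashuf r t f = (if nilp r then f t else 0) - (if nilp t then f (rev r) else 0).
Proof.
move=> Lf; elim: Lf r t => {f} [v f fE | f v h Lf IHf hE] r t.
  rewrite (eq_ashuf _ _ fE) !fE.
  case: r => [|x r]; first by case: t => [|y t]; rewrite ashuf_nil /= ?subr0.
  case: t => [|y t]; rewrite ?ashuf_lmulw_nil ?ashuf_lmulw !ashuf_unit /=.
    rewrite sub0r andbT; case: r => [|z r] //=; rewrite mulr0 !rev_cons.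
    by case: (rev r) => [|b s] /=; rewrite ?mulr0 //; case: s => [|c s]; rewrite ?mulr0.
  by rewrite andbF !mulr0 subr0 addr0 oppr0.
have f0 := lie_series_nil Lf.
case: r => [|x r].
  by rewrite ashuf_nil; case: t => [|y t] /=; rewrite ?subr0 // hE /= subrr subr0.
rewrite [nilp (x :: r)]/= sub0r (eq_ashuf _ _ hE).
rewrite (@eq_ashuf (fun w => rmulw f v w + -1 * lmulw v f w)); last first.
  by move=> w; rewrite mulN1r.
rewrite ashufD ashufZ mulN1r.
have [r0 [x0 [rE F0]]] := rcons_consP x r.
case: t => [|y t].
  rewrite ashuf_lmulw_nil rE ashuf_rmulw_nil !IHf -!rE f0 !if_same !sub0r.
  rewrite /= hE rev_cons rmulw_rcons -rev_cons rE rev_rcons /=; ring.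
have [t0 [y0 [tE G0]]] := rcons_consP y t.
rewrite ashuf_lmulw tE rE ashuf_rmulw -rE -tE !IHf /= !subr0 !sub0r oppr0.
by rewrite !mulrN F0 G0; ring.
Qed.

Definition dcontr phi f s t := \sum_x phi x * f (s ++ x :: t).

(** Let D f be the sum of phi(a_l) a_1..a_(l-1) (x) a_(l+1)..a_m, f' the contraction of the first
    letter, and c = phi(v). Then D(f v) = D(f) (1 (x) v) + c f (x) 1 and D(v f) = (v (x) 1) D(f) + c
    1 (x) f. On the other side [f, v] has first contraction f' v - c f; as v is primitive and S
    reverses products, (S (x) 1) Delta sends f' v to D(f) (1 (x) v) - (v (x) 1) D(f) by induction,
    and f to 1 (x) f - f (x) 1. The two sides agree. *)
Lemma dcontr_lie phi f s t : lie_series f ->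
  dcontr phi f s t = ashuf (rev s) t (dcontr phi f [::]).
Proof.
move=> Lf; elim: Lf s t => {f} [v f fE | f v h Lf IHf hE] s t.
  rewrite (@eq_ashuf (fun w => (\sum_x phi x * v x) * (nilp w)%:R)); last first.
    move=> w; rewrite /dcontr mulr_suml; apply: eq_bigr => x _.
    by rewrite fE /= mulrA.
  rewrite ashufZ ashuf_unit /dcontr mulr_suml; apply: eq_bigr => x _.
  rewrite fE -mulrA; congr (_ * _).
  case: s => [|y s] //=; rewrite /nilp size_rev /= mulr0.
  by case: s => [|z s] /=; rewrite mulr0.
have f0 := lie_series_nil Lf.
pose c := \sum_x phi x * v x.
have rC s' t' y : dcontr phi (rmulw f v) s' (rcons t' y) = dcontr phi f s' t' * v y.
  rewrite /dcontr mulr_suml; apply: eq_bigr => x _.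
  by rewrite -rcons_cons -rcons_cat rmulw_rcons mulrA.
have rN s' : dcontr phi (rmulw f v) s' [::] = c * f s'.
  rewrite /dcontr mulr_suml; apply: eq_bigr => x _.
  by rewrite cats1 rmulw_rcons mulrCA mulrC.
have lC x s' t' : dcontr phi (lmulw v f) (x :: s') t' = v x * dcontr phi f s' t'.
  by rewrite /dcontr mulr_sumr; apply: eq_bigr => y _; rewrite /= mulrCA.
have lN t' : dcontr phi (lmulw v f) [::] t' = c * f t'.
  by rewrite /dcontr mulr_suml; apply: eq_bigr => y _; rewrite /= mulrA.
have hD s' t' : dcontr phi h s' t' =
    dcontr phi (rmulw f v) s' t' - dcontr phi (lmulw v f) s' t'.
  by rewrite /dcontr -sumrB; apply: eq_bigr => x _; rewrite hE mulrBr.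
(* This is f' v - c f. On the empty word the identity relies on [f [::] = 0]. *)
rewrite (@eq_ashuf (fun w => rmulw (dcontr phi f [::]) v w + - c * f w)); last first.
  move=> w; rewrite hD lN mulNr; congr (_ - _).
  by case/lastP: w => [|w y]; rewrite ?rN ?f0 ?mulr0 // rC rmulw_rcons.
rewrite ashufD ashufZ (ashuf_lie _ _ Lf) hD revK.
case: s => [|x s]; case/lastP: t => [|t y]; rewrite ?rC ?rN ?lC ?lN.
- by rewrite ashuf_nil /= f0; ring.
- by rewrite !ashuf_nil rmulw_rcons /nilp size_rcons /=; ring.
- rewrite rev_cons ashuf_rmulw_nil IHf /nilp size_rcons /=; ring.
rewrite rev_cons ashuf_rmulw !IHf rev_cons /nilp !size_rcons /=; ring.
Qed.

(** * Rotations of signed shuffles *)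

Lemma rotsum1 (F : seq T -> R) s :
  \sum_(i < size s) F (rot 1 (rot i s)) = \sum_(i < size s) F (rot i s).
Proof.
case E: (size s) => [|n]; first by rewrite !big_ord0.
rewrite big_ord_recr [RHS]big_ord_recl /= rot0 addrC.
rewrite -rotS ?E // -E rot_size; congr (_ + _).
by apply: eq_bigr => i _; rewrite -rotS // E ltnW // ltnS ltn_ord.
Qed.

(** Rotating a shuffle moves its first letter, taken from r or from t, to the end. The result is a
    shuffle in which only that one word is rotated, a difference that the sum over all rotations of
    both words does not see. *)
Lemma ashuf_rot r t f : (0 < size r)%N -> (0 < size t)%N ->
  \sum_(i < size r) \sum_(j < size t)
    ashuf (rot i r) (rot j t) (fun w => f (rot 1 w)) =
  \sum_(i < size r) \sum_(j < size t) ashuf (rot i r) (rot j t) f.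
Proof.
move=> r0 t0.
(* [G1] and [G2] collect the shuffles whose moved letter comes from the first and from the second
   word. *)
pose G1 r t := if r is x :: r' then - ashuf r' t (fun w => f (rcons w x)) else 0.
pose G2 r t := if t is x :: t' then ashuf r t' (fun w => f (rcons w x)) else 0.
have H1 r' t' : (0 < size r')%N -> (0 < size t')%N ->
    ashuf r' t' (fun w => f (rot 1 w)) = G1 r' t' + G2 r' t'.
  case: r' t' => [|x r'] [|y t'] // _ _; rewrite ashuf_cons /G1 /G2.
  by congr (- _ + _); apply: eq_ashuf => w; rewrite rot1_cons.
have H2 r' t' : (0 < size r')%N -> (0 < size t')%N ->
    ashuf (rot 1 r') (rot 1 t') f = G1 r' (rot 1 t') + G2 (rot 1 r') t'.
  case: r' t' => [|x r'] [|y t'] // _ _.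
  by rewrite !rot1_cons ashuf_rcons.
transitivity (\sum_(i < size r) \sum_(j < size t)
    (G1 (rot i r) (rot j t) + G2 (rot i r) (rot j t))).
  by apply: eq_bigr => i _; apply: eq_bigr => j _; rewrite H1 ?size_rot.
transitivity (\sum_(i < size r) \sum_(j < size t)
    (G1 (rot i r) (rot 1 (rot j t)) + G2 (rot 1 (rot i r)) (rot j t))); last first.
  rewrite -(rotsum1 (fun r' => \sum_(j < size t) ashuf r' (rot j t) f)).
  apply: eq_bigr => i _; rewrite -(rotsum1 (fun t' => ashuf _ t' f)).
  by apply: eq_bigr => j _; rewrite H2 ?size_rot.
under eq_bigr do rewrite big_split; under [RHS]eq_bigr do rewrite big_split.
rewrite !big_split; congr (_ + _).
  by apply: eq_bigr => i _; rewrite (rotsum1 (G1 _)).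
by rewrite (rotsum1 (fun r' => \sum_(j < size t) G2 r' (rot j t))).
Qed.

End SignedShuffles.

Lemma iter_rot1 (T : Type) (i : nat) (s : seq T) :
  (i <= size s)%N -> iter i (rot 1) s = rot i s.
Proof.
elim: i => [|i IHi] lt_is; first by rewrite rot0.
by rewrite iterS IHi 1?ltnW // -rotS.
Qed.

(** This is the descent to cyclic words. By [ashuf_rot] the double sum is unchanged when f is
    precomposed with any rotation; adding up all of these gives a positive multiple of it on one
    side and 0 on the other. *)
Lemma ashuf_rotsum0 (T : finType) (R : numDomainType) (f : seq T -> R) (r t : seq T) :
  (0 < size r)%N -> (0 < size t)%N ->
  (forall w, size w = (size r + size t)%N -> \sum_(i < size w) f (rot i w) = 0) ->
  \sum_(i < size r) \sum_(j < size t) ashuf (rot i r) (rot j t) f = 0.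
Proof.
move=> r0 t0 f0; set S := LHS.
have S_iter m : \sum_(i < size r) \sum_(j < size t)
    ashuf (rot i r) (rot j t) (fun w => f (iter m (rot 1) w)) = S.
  elim: m => [|m IHm] //; rewrite -[RHS]IHm -[RHS]ashuf_rot //.
  by do 2![apply: eq_bigr => ? _]; apply: eq_ashuf => w; rewrite iterSr.
have : \sum_(m < size r + size t) S = 0.
  under eq_bigr => m _ do rewrite -(S_iter m).
  rewrite exchange_big big1 // => i _.
  rewrite exchange_big big1 // => j _; rewrite -ashuf_sum.
  rewrite -[RHS](ashuf0 _ (rot i r) (rot j t)).
  apply: eq_in_ashuf => w; rewrite !size_rot => sw; rewrite -[RHS](f0 w sw) sw.
  by apply: eq_bigr => m _; rewrite iter_rot1 // sw ltnW.
rewrite sumr_const card_ord => /eqP; rewrite mulrn_eq0 addn_eq0.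
by rewrite eqn0Ngt r0 => /eqP.
Qed.

(** * Tensors as functions on words *)

Section Coefficients.

Variable n : nat.

(** Extension by 0 to words of other lengths lets recursions on words run without length proofs. *)
Definition wcoef m (x : tens n m) (s : seq 'I_n) : rat := oapp x 0 (insub s).

Lemma wcoef_tuple m (x : tens n m) (w : m.-tuple 'I_n) : wcoef x w = x w.
Proof. by rewrite /wcoef valK. Qed.

Lemma wcoef_neq m (x : tens n m) s : size s != m -> wcoef x s = 0.
Proof. by rewrite /wcoef => sm; rewrite insubN. Qed.

Lemma wcoef_sum m (I : Type) (e : seq I) (X : I -> tens n m) s :
  wcoef (\sum_(i <- e) X i) s = \sum_(i <- e) wcoef (X i) s.
Proof.
rewrite /wcoef; case: insubP => [w _ _|_] /=; first by rewrite sum_ffunE.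
by rewrite big1.
Qed.

Lemma wcoefB m (x y : tens n m) s : wcoef (x - y) s = wcoef x s - wcoef y s.
Proof. by rewrite /wcoef; case: insubP => [w _ _|_] /=; rewrite ?ffunE ?subr0. Qed.

Lemma wcoef_lmul m v (x : tens n m) : wcoef (lmul v x) =1 lmulw v (wcoef x).
Proof.
case=> [|a s]; first exact: wcoef_neq.
have [sm|sm] := eqVneq (size s) m; last by rewrite /= !wcoef_neq ?mulr0.
have := wcoef_tuple (lmul v x) [tuple of a :: Tuple (introT eqP sm)].
rewrite /= => ->; rewrite ffunE theadE; congr (_ * _).
by rewrite -[LHS]wcoef_tuple.
Qed.

Lemma wcoef_rmul m v (x : tens n m) : wcoef (rmul x v) =1 rmulw (wcoef x) v.
Proof.
case/lastP=> [|s a]; first exact: wcoef_neq.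
rewrite rmulw_rcons.
have [sm|sm] := eqVneq (size s) m; last by rewrite !wcoef_neq ?mul0r // size_rcons.
pose w : m.-tuple 'I_n := Tuple (introT eqP sm).
have := wcoef_tuple (rmul x v) [tuple of rcons w a].
rewrite /= => ->; rewrite ffunE (tnth_nth a) /= nth_rcons sm ltnn eqxx.
congr (_ * _); rewrite -[RHS]/(wcoef x w) wcoef_tuple; congr (x _).
apply: eq_from_tnth => i; rewrite tnth_mktuple !(tnth_nth a) /= nth_rcons sm.
by rewrite ltn_ord.
Qed.

Lemma wcoef_lbrack m (a : 'I_m.+1 -> vecH n) : lie_series (wcoef (lbrack a)).
Proof.
elim: m a => [|m IHm] a.
  apply: (LieLetter (v := a ord0)) => s.
  have [|s1] := eqVneq (size s) 1%N; last first.
    by rewrite wcoef_neq //; case: s s1 => [|x [|y s]] //=; rewrite mulr0.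
  case: s => [|x [|y s]] // _; have := wcoef_tuple (lbrack a) [tuple x].
  by rewrite /= => ->; rewrite ffunE theadE mulr1.
apply: (LieBracket (v := a ord_max)
  (IHm (fun j => a (widen_ord (leqnSn m.+1) j)))) => s.
by rewrite /= wcoefB wcoef_rmul wcoef_lmul.
Qed.

Lemma dcontr_isLie m (u : tens n m.+1) phi s t : isLie u ->
  dcontr phi (wcoef u) s t = ashuf (rev s) t (dcontr phi (wcoef u) [::]).
Proof.
case=> r [A ->].
have sumE s' t' : dcontr phi (wcoef (\sum_(j < r) lbrack (A j))) s' t' =
    \sum_(j < r) dcontr phi (wcoef (lbrack (A j))) s' t'.
  rewrite exchange_big; apply: eq_bigr => x _.
  by rewrite wcoef_sum mulr_sumr.
rewrite (eq_ashuf _ _ (sumE [::])) ashuf_sum sumE; apply: eq_bigr => j _.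
exact/dcontr_lie/wcoef_lbrack.
Qed.

End Coefficients.

(** * Kernels of the projections to cyclic words *)

Section CyclicWords.

Variable n : nat.

Lemma etens_rot m (a : 'I_m -> vecH n) (w : m.-tuple 'I_n) :
  etens (fun i => a (ordS i)) (rot_tuple 1 w) = etens a w.
Proof.
rewrite !ffunE [RHS](reindex_inj (@ordS_inj m)).
apply: eq_bigr => i _; congr (a _ _).
case: m a w i => [|m] a w i; first by case: i.
rewrite !(tnth_nth (thead w)) /= nth_cat size_drop nth_drop size_tuple add1n.
rewrite subSS subn0; case: ltnP => im; first by rewrite modn_small.
(* At the last index [ordS] wraps to 0, where the rotated word carries the first letter of [w]. *)
have -> : val i = m by apply/eqP; rewrite eqn_leq -ltnS ltn_ord.
rewrite modnn subnn; case: w => [[|x w]] //.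
Qed.

(** Each relator is a tensor minus a rotated copy, and the two have the same sum over rotations. *)
Lemma kerpi_rotsum m (y : tens n m) s : kerpi y -> size s = m ->
  \sum_(i < m) wcoef y (rot i s) = 0.
Proof.
move=> + sm; subst m; case=> r [A ->].
under eq_bigr do rewrite wcoef_sum.
rewrite exchange_big big1 // => j _.
under eq_bigr do rewrite wcoefB.
rewrite sumrB; apply/eqP; rewrite subr_eq0 eq_sym; apply/eqP.
have etensE s' : size s' = size s ->
    wcoef (etens (fun i => A j (ordS i))) (rot 1 s') = wcoef (etens (A j)) s'.
  move=> s'm; pose w : (size s).-tuple 'I_n := Tuple (introT eqP s'm).
  have := etens_rot (A j) w; rewrite -!wcoef_tuple //.
rewrite -rotsum1; apply: eq_bigr => i _.
by rewrite etensE // size_rot.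
Qed.

Definition catf (X : Type) r r' (f : 'I_r -> X) (g : 'I_r' -> X) : 'I_(r + r') -> X :=
  fun j => match split j with inl i => f i | inr i => g i end.

Lemma sum_catf (X Y : Type) (Z : nmodType) r r' (F : X -> Y -> Z)
    (f : 'I_r -> X) (g : 'I_r' -> X) (f' : 'I_r -> Y) (g' : 'I_r' -> Y) :
  \sum_j F (catf f g j) (catf f' g' j) = \sum_j F (f j) (f' j) + \sum_j F (g j) (g' j).
Proof.
rewrite big_split_ord; congr (_ + _); apply: eq_bigr => j _; rewrite /catf.
  by rewrite (unsplitK (inl _ j)).
by rewrite (unsplitK (inr _ j)).
Qed.

Variables p q : nat.
Implicit Types y : bitens n p q.

Lemma kerpi2_0 : kerpi2 (0 : bitens n p q).
Proof.
exists 0%N, (fun _ _ => 0), (fun _ _ => 0), 0%N, (fun _ _ => 0), (fun _ _ => 0).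
by rewrite !big_ord0 addr0.
Qed.

Lemma kerpi2D y y' : kerpi2 y -> kerpi2 y' -> kerpi2 (y + y').
Proof.
case=> r1 [A [B [r2 [A' [B' ->]]]]] [r3 [C [D [r4 [C' [D' ->]]]]]].
exists _, (catf A C), (catf B D), _, (catf A' C'), (catf B' D').
rewrite (sum_catf (fun a b => outer (cycrel a) (etens b))).
by rewrite (sum_catf (fun a b => outer (etens a) (cycrel b))) addrACA.
Qed.

Lemma kerpi2_sum (I : Type) (e : seq I) (P : pred I) (Y : I -> bitens n p q) :
  (forall i, P i -> kerpi2 (Y i)) -> kerpi2 (\sum_(i <- e | P i) Y i).
Proof. by move=> KY; apply: big_ind => //; [exact: kerpi2_0 | exact: kerpi2D]. Qed.

(** [kerpi2] lists relators without scalars, so a coefficient is absorbed into the first entry of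
    the pure tensor factor, which must have positive length. *)
Definition scale_head m (c : rat) (a : 'I_m -> vecH n) : 'I_m -> vecH n :=
  fun i => if val i == 0%N then [ffun x => c * a i x] else a i.

Lemma etens_scale_head m c (a : 'I_m -> vecH n) w :
  (0 < m)%N -> etens (scale_head c a) w = c * etens a w.
Proof.
case: m a w => // m a w _; rewrite !ffunE !big_ord_recl /scale_head /= ffunE mulrA.
by [].
Qed.

Lemma kerpi2Z c y : (0 < p)%N -> (0 < q)%N -> kerpi2 y -> kerpi2 [ffun w => c * y w].
Proof.
move=> p0 q0 [r1 [A [B [r2 [A' [B' ->]]]]]].
exists r1, A, (fun j => scale_head c (B j)), r2, (fun j => scale_head c (A' j)), B'.
apply/ffunP => w; rewrite !ffunE !sum_ffunE mulrDr !mulr_sumr.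
congr (_ + _); apply: eq_bigr => j _.
  by rewrite [in LHS]ffunE [RHS]ffunE etens_scale_head // mulrCA.
by rewrite [in LHS]ffunE [RHS]ffunE etens_scale_head // mulrA.
Qed.

Lemma etens_delta m (s : m.-tuple 'I_n) w :
  etens (fun i => [ffun x => (x == tnth s i)%:R]) w = (w == s)%:R :> rat.
Proof.
rewrite ffunE; have [->|] := eqVneq w s.
  by rewrite big1 // => i _; rewrite ffunE eqxx.
move=> ws; have /existsP[i /negbTE wi] : [exists i, tnth w i != tnth s i].
  apply: contraR ws => /existsPn ws; apply/eqP/eq_from_tnth => i.
  exact/eqP/negPn/ws.
by rewrite (bigD1 i) //= ffunE wi mul0r.
Qed.

Lemma cycrel_delta m (s w : m.-tuple 'I_n) :
  cycrel (fun i => [ffun x => (x == tnth s i)%:R]) w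
    = (w == s)%:R - (w == rot_tuple 1 s)%:R :> rat.
Proof.
have rotK1 : rot_tuple 1 (rotr_tuple 1 w) = w by apply: val_inj; rewrite /= rotrK.
rewrite /cycrel [LHS]ffunE [X in _ + X]ffunE etens_delta -[in X in - X]rotK1.
rewrite (etens_rot (fun i => [ffun x => (x == tnth s i)%:R])) etens_delta.
congr (_ - _%:R); congr (nat_of_bool _); apply/eqP/eqP => [<- // | ->].
by apply: val_inj; rewrite /= rotK.
Qed.

Lemma sum_tuple_delta m (F : m.-tuple 'I_n -> rat) w :
  \sum_s F s * (w == s)%:R = F w.
Proof.
rewrite (bigD1 w) //= eqxx mulr1 big1 ?addr0 // => s.
by rewrite eq_sym => /negbTE ->; rewrite mulr0.
Qed.

Lemma sum_tuple_delta_rot m (F : m.-tuple 'I_n -> rat) w :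
  \sum_s F s * (w == rot_tuple 1 s)%:R = F (rotr_tuple 1 w).
Proof.
rewrite -sum_tuple_delta; apply: eq_bigr => s _; congr (_ * _%:R).
congr (nat_of_bool _); apply/eqP/eqP => [-> | <-]; apply: val_inj => /=.
  by rewrite rotK.
by rewrite rotrK.
Qed.

Hypotheses (p0 : (0 < p)%N) (q0 : (0 < q)%N).

Lemma kerpi2_gen c y (A : 'I_p -> vecH n) (B : 'I_q -> vecH n) :
  (forall w, y w = c * (cycrel A w.1 * etens B w.2)) \/
  (forall w, y w = c * (etens A w.1 * cycrel B w.2)) -> kerpi2 y.
Proof.
case=> yE.
  exists 1%N, (fun _ => A), (fun _ => scale_head c B), 0%N, (fun _ => A), (fun _ => B).
  rewrite big_ord1 big_ord0 addr0; apply/ffunP => w.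
  by rewrite yE [RHS]ffunE etens_scale_head // mulrCA.
exists 0%N, (fun _ => A), (fun _ => B), 1%N, (fun _ => scale_head c A), (fun _ => B).
rewrite big_ord1 big_ord0 add0r; apply/ffunP => w.
by rewrite yE [RHS]ffunE etens_scale_head // mulrA.
Qed.

(** Expand y over basis bitensors: each one minus its rotation in the first factor is a relator.
    Rotating basis words by [rot] rotates coefficient functions by [rotr]. *)
Lemma kerpi2_rotr1 y :
  kerpi2 [ffun w => y w - y (rotr_tuple 1 w.1, w.2)].
Proof.
pose K (s1 : p.-tuple 'I_n) (s2 : q.-tuple 'I_n) : bitens n p q :=
  [ffun w => y (s1, s2) *
    (((w.1 == s1)%:R - (w.1 == rot_tuple 1 s1)%:R) * (w.2 == s2)%:R)].
suff -> : [ffun w => y w - y (rotr_tuple 1 w.1, w.2)] = \sum_s1 \sum_s2 K s1 s2.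
  apply: kerpi2_sum => s1 _; apply: kerpi2_sum => s2 _; apply: kerpi2_gen; left => w.
  by rewrite ffunE -cycrel_delta -etens_delta.
apply/ffunP => -[w1 w2]; rewrite sum_ffunE ffunE /=.
under [RHS]eq_bigr do rewrite sum_ffunE.
transitivity (\sum_s1 y (s1, w2) * ((w1 == s1)%:R - (w1 == rot_tuple 1 s1)%:R)).
  under [RHS]eq_bigr do rewrite mulrBr.
  rewrite sumrB (sum_tuple_delta (fun s1 => y (s1, w2))).
  by rewrite (sum_tuple_delta_rot (fun s1 => y (s1, w2))).
apply: eq_bigr => s1 _; rewrite -(sum_tuple_delta (fun s2 => y (s1, s2))) mulr_suml.
by apply: eq_bigr => s2 _; rewrite ffunE /=; ring.
Qed.

Lemma kerpi2_rot1 y :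
  kerpi2 [ffun w => y w - y (w.1, rot_tuple 1 w.2)].
Proof.
(* Here coefficients rotate the other way: with z the rotated y, the difference is minus that of z
   and its [rotr] rotation, hence the sign and the rotated argument. *)
pose K (s1 : p.-tuple 'I_n) (s2 : q.-tuple 'I_n) : bitens n p q :=
  [ffun w => - y (s1, rot_tuple 1 s2) *
    ((w.1 == s1)%:R * ((w.2 == s2)%:R - (w.2 == rot_tuple 1 s2)%:R))].
suff -> : [ffun w => y w - y (w.1, rot_tuple 1 w.2)] = \sum_s1 \sum_s2 K s1 s2.
  apply: kerpi2_sum => s1 _; apply: kerpi2_sum => s2 _; apply: kerpi2_gen; right => w.
  by rewrite ffunE -cycrel_delta -etens_delta.
apply/ffunP => -[w1 w2]; rewrite sum_ffunE ffunE /=.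
under [RHS]eq_bigr do rewrite sum_ffunE.
rewrite exchange_big /=.
transitivity (\sum_s2 - y (w1, rot_tuple 1 s2) *
                ((w2 == s2)%:R - (w2 == rot_tuple 1 s2)%:R)).
  under [RHS]eq_bigr do rewrite mulrBr.
  rewrite sumrB (sum_tuple_delta (fun s2 => - y (w1, rot_tuple 1 s2))).
  rewrite (sum_tuple_delta_rot (fun s2 => - y (w1, rot_tuple 1 s2))) opprK addrC.
  by congr (_ + y (_, _)); apply: val_inj; rewrite /= rotrK.
apply: eq_bigr => s2 _.
rewrite -(sum_tuple_delta (fun s1 => - y (s1, rot_tuple 1 s2))) mulr_suml.
by apply: eq_bigr => s1 _; rewrite ffunE /=; ring.
Qed.

(* Opposite directions: the words over which ashuf sums involve the mirror image
   of the first component. *)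
Definition rot_pair i j (w : p.-tuple 'I_n * q.-tuple 'I_n) :=
  (iter i (fun s => rotr_tuple 1 s) w.1, iter j (fun s => rot_tuple 1 s) w.2).

(** Differences between y and its rotations lie in the kernel, one rotation at a time. Their average
    over all p q rotations is y itself, since the rotated copies add up to 0. *)
Lemma kerpi2_rotsum y :
  (forall w, \sum_(i < p) \sum_(j < q) y (rot_pair i j w) = 0) ->
  kerpi2 y.
Proof.
move=> y0.
have Krot i j :
    kerpi2 [ffun w => y w - y (rot_pair i j w)].
  rewrite /rot_pair; elim: i => [|i IHi].
    elim: j => [|j IHj].
      have := kerpi2_0; congr kerpi2; apply/ffunP => -[w1 w2].
      by rewrite !ffunE subrr.
    have := kerpi2D IHj (kerpi2_rot1
      [ffun w => y (w.1, iter j (fun s => rot_tuple 1 s) w.2)]).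
    by congr kerpi2; apply/ffunP => w; rewrite !ffunE /= addrA subrK -iterSr.
  have := kerpi2D IHi (kerpi2_rotr1 [ffun w => y (rot_pair i j w)]).
  by congr kerpi2; apply/ffunP => w; rewrite !ffunE /rot_pair /= addrA subrK -iterSr.
have pq0 : (p%:R * q%:R : rat) != 0 by rewrite mulf_neq0 // pnatr_eq0 -lt0n.
suff <- : [ffun w => (p%:R * q%:R)^-1 * (\sum_(i < p) \sum_(j < q) 
    [ffun w => y w - y (rot_pair i j w)] : bitens n p q) w] = y.
  by apply: kerpi2Z => //; apply: kerpi2_sum => i _; apply: kerpi2_sum => j _.
apply/ffunP => w; rewrite ffunE sum_ffunE.
under eq_bigr => i _.
  rewrite sum_ffunE; under eq_bigr => j _ do rewrite ffunE.
  rewrite sumrB; over.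
rewrite sumrB y0 subr0 !sumr_const !card_ord -mulrnA mulnC.
rewrite -[y w *+ _]mulr_natr natrM mulrCA.
by rewrite mulVf // mulr1.
Qed.

End CyclicWords.

(** * Double contractions, c_k and delta_k *)

Section Contractions.

Variables (n k : nat) (om : 'M[rat]_n).

Definition contr (x : tens n k.+2) (s t : seq 'I_n) : rat :=
  \sum_a \sum_b om a b * wcoef x (a :: s ++ b :: t).

Lemma sum_pair_delta (F : 'I_n -> 'I_n -> rat) (a b : 'I_n) (P Q : bool) :
  \sum_c \sum_d F c d * [&& a == c, P, b == d & Q]%:R = F a b * (P && Q)%:R.
Proof.
rewrite (bigD1 a) //= [X in _ + X]big1 ?addr0; last first.
  move=> c; rewrite eq_sym => /negbTE ca.
  by rewrite big1 // => d _; rewrite ca mulr0.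
rewrite (bigD1 b) //= big1 ?addr0 ?eqxx //.
by move=> d; rewrite eq_sym => /negbTE db; rewrite db ?eqxx ?andbF mulr0.
Qed.

(** Merges the two words and the contracted letters into the single word a A b B, on which rotations
    act. The length factor records where A ends. *)
Lemma sum_word_delta (A B : seq 'I_n) (a b : 'I_n) p q
    (y : p.-tuple 'I_n * q.-tuple 'I_n) :
  om a b * bb p q A B y = (size A == p)%:R *
    \sum_c \sum_d om c d * (a :: A ++ b :: B == c :: y.1 ++ d :: y.2)%:R.
Proof.
case: y => s t; rewrite ffunE /=.
have [Ap|/negbTE Ap] := eqVneq (size A) p; last first.
  rewrite mul0r; case: eqP => [sA|_]; last by rewrite mulr0.
  by rewrite -sA size_tuple eqxx in Ap.
rewrite mul1r (eq_sym _ A) (eq_sym _ B) -sum_pair_delta.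
apply: eq_bigr => c _; apply: eq_bigr => d _.
by rewrite eqseq_cons eqseq_cat ?eqseq_cons // Ap size_tuple.
Qed.

Lemma sum_coef_delta (x : tens n k.+2) (z : seq 'I_n) : size z = k.+2 ->
  \sum_(w : k.+2.-tuple 'I_n) x w * (val w == z)%:R = wcoef x z.
Proof.
move=> zk; pose w : k.+2.-tuple 'I_n := Tuple (introT eqP zk).
rewrite -[z]/(val w) wcoef_tuple -sum_tuple_delta.
by apply: eq_bigr => s _; rewrite eq_sym.
Qed.

Lemma wcoef_ck_pre (x : tens n k.+2) s : size s = k ->
  wcoef (ck_pre om x) s = contr x [::] s.
Proof.
move=> sk; pose y : k.-tuple 'I_n := Tuple (introT eqP sk).
rewrite -[s]/(val y) wcoef_tuple ffunE /contr.
transitivity (\sum_(w : k.+2.-tuple 'I_n) \sum_a \sum_b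
    om a b * (x w * (val w == a :: b :: y)%:R)).
  apply: eq_bigr => -[[|a [|b w]] wk] // _.
  rewrite (tnth_nth a) (tnth_nth a) /= inordK // -mulrA.
  have := sum_word_delta [::] w a b ([tuple], y).
  rewrite !ffunE /= drop0 mul1r => ->; rewrite mulr_sumr; apply: eq_bigr => c _.
  by rewrite mulr_sumr; apply: eq_bigr => d _; rewrite mulrCA.
rewrite exchange_big; apply: eq_bigr => a _.
rewrite exchange_big; apply: eq_bigr => b _.
by rewrite -mulr_sumr sum_coef_delta //= sk.
Qed.

(** Reindexing the words by the rotation removes it, because x is invariant. *)
Lemma sum_rot_delta (x : tens n k.+2) i p q (y : p.-tuple 'I_n * q.-tuple 'I_n) :
  (forall w : k.+2.-tuple 'I_n, x (rot_tuple i w) = x w) -> (p + q)%N = k ->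
  \sum_(w : k.+2.-tuple 'I_n) x w *
    (\sum_a \sum_b om a b * (rot i w == a :: y.1 ++ b :: y.2)%:R) = contr x y.1 y.2.
Proof.
move=> xi pq.
transitivity (\sum_(w : k.+2.-tuple 'I_n) \sum_a \sum_b
    om a b * (x w * (rot i w == a :: y.1 ++ b :: y.2)%:R)).
  apply: eq_bigr => w _; rewrite mulr_sumr; apply: eq_bigr => a _.
  by rewrite mulr_sumr; apply: eq_bigr => b _; rewrite mulrCA.
rewrite exchange_big; apply: eq_bigr => a _.
rewrite exchange_big; apply: eq_bigr => b _.
rewrite -mulr_sumr -sum_coef_delta; last first.
  by rewrite /= size_cat /= !size_tuple addnS pq.
have rot_inj : injective (fun w : k.+2.-tuple 'I_n => rot_tuple i w).
  by move=> w w' /(congr1 val) /= /rot_inj /val_inj.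
rewrite [in RHS](reindex_inj rot_inj); congr (_ * _).
by apply: eq_bigr => w _; rewrite xi.
Qed.

(* The two summands of the (i, j) term of delta_pre become the same double
   contraction after rotating the word so that it starts at i, resp. at j. *)
Lemma delta_pre_cyclic (x : tens n k.+2) p q : om^T = - om ->
  (forall w : k.+2.-tuple 'I_n, x (rot_tuple 1 w) = x w) -> (p + q)%N = k ->
  exists c, forall y, delta_pre p q om x y = c * contr x y.1 y.2.
Proof.
move=> om_skew x1 pq.
have xr i (w : k.+2.-tuple 'I_n) : (i <= k.+2)%N -> x (rot_tuple i w) = x w.
  elim: i => [|i IHi] ik; first by congr (x _); apply: val_inj; rewrite /= rot0.
  rewrite -IHi 1?ltnW // -[RHS]x1; congr (x _); apply: val_inj => /=.
  by rewrite -rotS // size_tuple.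
(* The multiple counts the admissible pairs whose inner arc has length p, plus those whose outer arc
   has length p. *)
exists (\sum_(i < k.+2) \sum_(j < k.+2 | (i < j)%N && (1 < j - i < k.+1)%N)
  ((j - i - 1 == p)%N%:R + (k.+2 - j.+1 + i == p)%N%:R)) => y.
rewrite ffunE; under eq_bigr do rewrite mulr_sumr.
rewrite exchange_big mulr_suml; apply: eq_bigr => i _.
under eq_bigr do rewrite mulr_sumr.
rewrite exchange_big mulr_suml; apply: eq_bigr => j /andP[ij _].
rewrite mulrDl -{1}(@sum_rot_delta x i p q y) //; last by move=> w; apply/xr/ltnW.
rewrite -(@sum_rot_delta x j p q y) //; last by move=> w; apply/xr/ltnW.
rewrite !mulr_sumr -big_split; apply: eq_bigr => w _ /=.
rewrite [X in _ = X + _]mulrCA [X in _ = _ + X]mulrCA -mulrDr; congr (_ * _).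
rewrite mulrBr -mulNr.
(* Skew-symmetry absorbs the minus sign of the second summand, so the two counts add. *)
have -> : - om (tnth w i) (tnth w j) = om (tnth w j) (tnth w i).
  by have /matrixP/(_ (tnth w i) (tnth w j)) := om_skew; rewrite !mxE => ->.
rewrite !sum_word_delta size_cat !size_drop !size_takel ?size_drop ?size_tuple;
  last 2 first.
- by rewrite ltnW.
- by rewrite -subnDA addn1 leq_sub2r // ltnW.
set a := tnth w i; set b := tnth w j.
have wa : drop i w = a :: drop i.+1 w.
  by rewrite /a (tnth_nth a) -drop_nth // size_tuple.
have wb : drop j w = b :: drop j.+1 w.
  by rewrite /b (tnth_nth b) -drop_nth // size_tuple.
have jE : (j = (j - i - 1) + i.+1 :> nat)%N by rewrite -subnDA addn1 subnK.
have wab : drop i.+1 w = take (j - i - 1) (drop i.+1 w) ++ b :: drop j.+1 w.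
  by rewrite -wb {2}jE -drop_drop cat_take_drop.
have rotiE : rot i w =
    a :: take (j - i - 1) (drop i.+1 w) ++ b :: (drop j.+1 w ++ take i w).
  by rewrite /rot wa {1}wab /= -catA.
have rotjE : rot j w =
    b :: (drop j.+1 w ++ take i w) ++ a :: take (j - i - 1) (drop i.+1 w).
  rewrite /rot wb /= -catA; congr (_ :: _ ++ _).
  have jE' : (j = i + (j - i - 1).+1 :> nat)%N by rewrite {1}jE addnC addSnnS.
  by rewrite {1}jE' takeD wa.
by rewrite rotiE rotjE.
Qed.

Variables (r : nat) (v : 'I_r -> vecH n) (u : 'I_r -> tens n k.+1).
Let x : tens n k.+2 := \sum_j lmul (v j) (u j).

(** The hypothesis says that the sum of the v_j (x) u_j equals that of the u_j (x) v_j, which is x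
    with its first letter moved to the end. *)
Lemma rot_ker_brk (w : k.+2.-tuple 'I_n) :
  \sum_j brk (v j) (u j) = 0 -> x (rot_tuple 1 w) = x w.
Proof.
rewrite sumrB => /eqP; rewrite subr_eq0 => /eqP xE.
rewrite /x {1}xE -!wcoef_tuple !wcoef_sum /=; apply: eq_bigr => j _.
case: w => -[|a s] sk //=.
by rewrite rot1_cons wcoef_rmul rmulw_rcons wcoef_lmul /= mulrC.
Qed.

(** Pairing with the first letter of v_j (x) u_j contracts u_j with the functional v_j^*, which
    takes the role of phi. *)
Lemma contr_lie s t : (forall j, isLie (u j)) ->
  contr x s t = ashuf (rev s) t (contr x [::]).
Proof.
move=> Lu.
have contrE s' t' : contr x s' t' =
    \sum_j dcontr (fun b => \sum_a om a b * v j a) (wcoef (u j)) s' t'.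
  rewrite /dcontr; under [RHS]eq_bigr do under eq_bigr do rewrite mulr_suml.
  under [RHS]eq_bigr do rewrite exchange_big.
  rewrite [RHS]exchange_big; apply: eq_bigr => a _.
  rewrite [RHS]exchange_big; apply: eq_bigr => b _.
  rewrite wcoef_sum mulr_sumr; apply: eq_bigr => j _.
  by rewrite wcoef_lmul /= mulrA.
rewrite (eq_ashuf _ _ (contrE [::])) ashuf_sum contrE; apply: eq_bigr => j _.
exact: dcontr_isLie.
Qed.

End Contractions.

(* An element of h_{g,1}(k) is x = sum_j v_j (x) u_j with u_j in L(k+1) and
   sum_j [v_j, u_j] = 0.  c_k(x) = 0 means ck_pre x lies in ker pi_k;
   delta_k(x) = 0 means each (p,q)-component lies in ker(pi_p (x) pi_q). *)
Theorem theorem1p1 (g k : nat) (hg : (1 <= g)%N) (hk : (1 <= k)%N)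
    (hgk : (k + 2 <= 2 * g)%N)
    (om : 'M[rat]_(2 * g)) (om_skew : om^T = - om) (om_nd : \det om != 0)
    (r : nat) (v : 'I_r -> vecH (2 * g)) (u : 'I_r -> tens (2 * g) k.+1)
    (hu : forall j, isLie (u j))
    (hker : \sum_(j < r) brk (v j) (u j) = 0)
    (hc : kerpi (ck_pre om (\sum_(j < r) lmul (v j) (u j)))) :
  forall p q : nat, (1 <= p)%N -> (1 <= q)%N -> (p + q)%N = k ->
    kerpi2 (delta_pre p q om (\sum_(j < r) lmul (v j) (u j))).
Proof.
move=> p q p0 q0 pq; set x := \sum_j _ in hc *.
have [c cE] := delta_pre_cyclic om_skew (fun w => rot_ker_brk w hker) pq.
apply: kerpi2_rotsum => // -[s t] /=.
under eq_bigr do under eq_bigr do rewrite cE contr_lie //=.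
under eq_bigr do rewrite -mulr_sumr.
rewrite -mulr_sumr -[RHS](mulr0 c); congr (_ * _).
(* Reversal turns the right rotations of [rot_pair] into the left rotations summed in
   [ashuf_rotsum0]. *)
have revE i : (i <= p)%N -> rev (iter i (fun s => rotr_tuple 1 s) s) = rot i (rev s).
  elim: i => [|i IHi] ip; first by rewrite rot0.
  by rewrite iterS /= rev_rotr IHi 1?ltnW // -rotS // size_rev size_tuple.
have rotE j : (j <= q)%N -> iter j (fun s => rot_tuple 1 s) t = rot j t :> seq _.
  elim: j => [|j IHj] jq; first by rewrite rot0.
  by rewrite iterS /= IHj 1?ltnW // -rotS // size_tuple.
transitivity (\sum_(i < p) \sum_(j < q)
    ashuf (rot i (rev s)) (rot j t) (contr om x [::])).
  apply: eq_bigr => i _; apply: eq_bigr => j _.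
  by rewrite revE 1?ltnW // rotE // ltnW.
(* On words of length k, [contr om x [::]] is the coefficient function of c_k(x); its rotation sums
   vanish by [hc]. *)
have := @ashuf_rotsum0 _ _ (contr om x [::]) (rev s) t.
rewrite size_rev !size_tuple pq; apply=> // w wk; rewrite wk -[RHS](kerpi_rotsum hc wk).
by apply: eq_bigr => i _; rewrite wcoef_ck_pre // size_rot.
Qed.
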